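(* There exist absolute constants $C>0$ and $C'>0$ such that the following holds. Let $p$ be a prime, let $d\geq1$ be an integer, let $E\subseteq\mathbb{C}$ be an arbitrary set, and let $F(p,\cdot)$ be a function of a real variable with values in $\mathbb{R}\cup\{+\infty\}$ such that $F(p,\delta)=+\infty$ whenever $p\delta$ is not an integer. Suppose that for every function $h\colon\mathbb{Z}_p\to E\cup\{0\}$ the bound $$\|\hat h\|_1\geq F(p,\delta)$$ holds, where $\delta=|\operatorname{supp}h|\,p^{-1}$. Then for every function $f\colon\mathbb{Z}_p^d\to E\cup\{0\}$ with $|\operatorname{supp}f|=\delta p^d$, where $\delta\geq Cp^{-1}$, we have $$\|\hat f\|_1\geq F(p,\delta')$$ for some real number $\delta'$ with $|\delta'-\delta|\leq C'\delta^{1/2}p^{-1/2}$.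
   Context: $\mathbb{Z}_p=\mathbb{Z}/p\mathbb{Z}$ and $\operatorname{supp}f=\{x: f(x)\neq0\}$. For $f\colon\mathbb{Z}_p^d\to\mathbb{C}$ (with $d\geq1$; the case $d=1$ is $\mathbb{Z}_p$) the Fourier transform is $\hat f(\xi)=p^{-d}\sum_{x\in\mathbb{Z}_p^d}f(x)e^{-2\pi i(\xi_1x_1+\dots+\xi_dx_d)/p}$ for $\xi\in\mathbb{Z}_p^d$, and the Wiener norm of $f$ is $\|\hat f\|_1=\sum_{\xi\in\mathbb{Z}_p^d}|\hat f(\xi)|$. *)

(* Defs.v *)
From HB Require Import structures.
From mathcomp Require Import all_boot all_order all_algebra.
From mathcomp Require Import all_classical all_reals all_analysis.
From mathcomp Require Import complex.

Set Implicit Arguments.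
Unset Strict Implicit.
Unset Printing Implicit Defensive.

Import Order.TTheory GRing.Theory Num.Theory.
Import numFieldNormedType.Exports.

Local Open Scope ring_scope.
Local Open Scope complex_scope.

(* e^{it} for real t. *)
Definition expi (R : realType) (t : R) : R[i] := cos t +i* sin t.

(* Z_p^d is 'rV['F_p]_d, the type 'F_p being Z/pZ when p is prime. Its elements
   are represented by naturals below p, and xi.x is computed on these
   representatives; the exponential only depends on it modulo p. *)
Definition fourier (R : realType) (p d : nat) (f : 'rV['F_p]_d -> R[i])
    (xi : 'rV['F_p]_d) : R[i] :=
  (p%:R ^+ d)^-1 *
  \sum_(x : 'rV['F_p]_d)
    f x * expi (- (2 * pi * (\sum_(i < d) (xi 0%R i : nat) * (x 0%R i : nat))%N%:R
                   / p%:R)).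

(* normc is the real-valued modulus, whereas `|z| lives in R[i]. *)
Definition wiener_norm (R : realType) (p d : nat) (f : 'rV['F_p]_d -> R[i]) : R :=
  \sum_(xi : 'rV['F_p]_d) ComplexField.Normc.normc (fourier f xi).

(* Main.v *)
Require Import Defs.
From mathcomp Require Import all_boot all_order all_algebra.
From mathcomp Require Import all_classical all_reals all_analysis.
From mathcomp Require Import complex.
From mathcomp Require Import ring lra.

Set Implicit Arguments.
Unset Strict Implicit.
Unset Printing Implicit Defensive.

Import Order.TTheory GRing.Theory Num.Theory.
Import numFieldNormedType.Exports.

Local Open Scope classical_set_scope.
Local Open Scope ring_scope.

(** The function [f] is compared with its restrictions to lines,
    [h t = f (a + t v)] for [t] in Z_p.

    Restricting cannot increase the Wiener norm: by Fourier inversion the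
    coefficient of [h] at [eta] is the sum of the coefficients of [f], each
    twisted by a unimodular factor, over the frequencies [xi] with
    [xi . v = eta], and every [xi] contributes to exactly one [eta]
    ([fourier_affine], [wiener_norm_affine]). As [h] has its values in the same
    set as [f], the hypothesis bounds the Wiener norm of [f] from below by the
    value of [F] at the density of the support of [h].

    It remains to find a line on which that density is close to [delta]. For
    [a] and [v] uniform and independent, the points [a + t v] are pairwise
    independent as [t] varies, so the number of points of the support met by
    the line has mean [p delta] and variance [p delta (1 - delta)]
    ([line_second_moment], [exists_balanced_line]). Some line thus deviates
    from the mean by at most the square root of [p delta]; dividing by [p]
    gives the claim with both constants equal to 1. The degenerate direction
    [v = 0] is kept in the average, since it keeps the points exactly pairwise
    independent and the comparison of Wiener norms covers it as well. *)

(** * Additive characters of F_p *)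

Section Characters.
Variable R : realType.

Lemma expi0 : expi (0 : R) = 1.
Proof. by rewrite /expi cos0 sin0. Qed.

Lemma expiD (s t : R) : expi (s + t) = expi s * expi t.
Proof. by rewrite /expi cosD sinD; simpc; congr (_ +i* _)%C; rewrite addrC. Qed.

Lemma expiN (t : R) : expi (- t) = (expi t)^-1.
Proof.
have e1 : expi t * expi (- t) = 1 by rewrite -expiD subrr expi0.
have unit_e : expi t \is a GRing.unit.
  by apply/unitrPr; exists (expi (- t)).
by apply: (mulrI unit_e); rewrite e1 divrr.
Qed.

Lemma normc_expi (t : R) : ComplexField.Normc.normc (expi t) = 1.
Proof. by rewrite /= cos2Dsin2 sqrtr1. Qed.

Lemma expi_2pi_nat (k : nat) : expi (2 * pi * k%:R : R) = 1.
Proof.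
elim: k => [|k IHk]; first by rewrite mulr0 expi0.
rewrite -[k.+1%:R]natr1 mulrDr mulr1 expiD IHk mul1r mulr_natl.
by rewrite /expi cos2pi sin2pi.
Qed.

(** From [cos (2 s) = 1 - 2 sin^2 s], the value 1 would force [sin s = 0],
    whereas the sine does not vanish on the open interval from 0 to pi. *)
Lemma expi_neq1 (s : R) : 0 < s < pi -> expi (2 * s) != 1.
Proof.
move=> /sin_gt0_pi s_gt0; apply/eqP => -[+ _].
rewrite mulr_natl cos_mulr2n cos2sin2 => e1.
by have : 0 < sin s ^+ 2 by [exact: exprn_gt0]; lra.
Qed.

Variables (p : nat) (p_pr : prime p).

Let p_gt0 : 0 < p%:R :> R.
Proof. by rewrite ltr0n prime_gt0. Qed.

Definition chi (c : 'F_p) : R[i] := expi (2 * pi * (c : nat)%:R / p%:R).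

Lemma chi_nat (n : nat) : expi (2 * pi * n%:R / p%:R) = chi n%:R.
Proof.
rewrite /chi val_Fp_nat // {1}(divn_eq n p) natrD natrM mulrDr mulrDl expiD.
by rewrite -!mulrA mulfV ?gt_eqF // mulr1 mulrA expi_2pi_nat mul1r mulrA.
Qed.

Lemma chi0 : chi 0 = 1.
Proof. by rewrite /chi mulr0 mul0r expi0. Qed.

Lemma natr_valFp (c : 'F_p) : (c : nat)%:R = c.
Proof. exact: natr_Zp. Qed.

Lemma chiD (b c : 'F_p) : chi (b + c) = chi b * chi c.
Proof.
rewrite -[in LHS](natr_valFp b) -[in LHS](natr_valFp c) -natrD -chi_nat.
by rewrite natrD mulrDr mulrDl expiD.
Qed.

Lemma chiN (c : 'F_p) : chi (- c) = (chi c)^-1.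
Proof.
have e1 : chi c * chi (- c) = 1 by rewrite -chiD subrr chi0.
have unit_e : chi c \is a GRing.unit by apply/unitrPr; exists (chi (- c)).
by apply: (mulrI unit_e); rewrite e1 divrr.
Qed.

Lemma normc_chi (c : 'F_p) : ComplexField.Normc.normc (chi c) = 1.
Proof. exact: normc_expi. Qed.

Lemma chi_neq1 (c : 'F_p) : c != 0 -> chi c != 1.
Proof.
move=> c_neq0; rewrite /chi -!mulrA; apply: expi_neq1.
have c_gt0 : (0 < c)%N by rewrite lt0n.
have c_ltp : (c < p)%N by rewrite -[X in (_ < X)%N](Fp_cast p_pr) ltn_ord.
have quo_gt0 : 0 < (c : nat)%:R / p%:R :> R by rewrite divr_gt0 // ltr0n.
rewrite (mulr_gt0 (pi_gt0 R) quo_gt0) /=.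
by rewrite gtr_pMr ?pi_gt0 // ltr_pdivrMr // mul1r ltr_nat.
Qed.

(** * Fourier inversion and restriction to affine subspaces *)

Definition dotp d (xi x : 'rV['F_p]_d) : 'F_p := (xi *m x^T) 0 0.

Lemma dotpDr d (xi x y : 'rV['F_p]_d) : dotp xi (x + y) = dotp xi x + dotp xi y.
Proof. by rewrite /dotp linearD mulmxDr mxE. Qed.

Lemma dotpBr d (xi x y : 'rV['F_p]_d) : dotp xi (x - y) = dotp xi x - dotp xi y.
Proof. by rewrite /dotp linearB mulmxBr !mxE. Qed.

Lemma dotpBl d (xi eta x : 'rV['F_p]_d) :
  dotp (xi - eta) x = dotp xi x - dotp eta x.
Proof. by rewrite /dotp mulmxBl !mxE. Qed.

Lemma dotpC d (xi x : 'rV['F_p]_d) : dotp xi x = dotp x xi.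
Proof.
by rewrite /dotp !mxE; apply: eq_bigr => i _; rewrite !mxE mulrC.
Qed.

Lemma dotp_mulmx m d (xi : 'rV['F_p]_d) (t : 'rV_m) (M : 'M['F_p]_(m, d)) :
  dotp xi (t *m M) = dotp (xi *m M^T) t.
Proof. by rewrite /dotp trmx_mul mulmxA. Qed.

Lemma fourierE d (f : 'rV['F_p]_d -> R[i]) xi :
  fourier f xi = (p%:R ^+ d)^-1 * \sum_x f x * chi (- dotp xi x).
Proof.
rewrite /fourier; congr (_ * _); apply: eq_bigr => x _; congr (_ * _).
rewrite expiN chi_nat chiN; congr (chi _)^-1.
rewrite natr_sum /dotp mxE; apply: eq_bigr => i _.
by rewrite natrM !natr_valFp mxE.
Qed.

(** Orthogonality: translating [x] by a vector on which the character
    [chi (dotp xi _)] is not 1 multiplies the sum by that value. *)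
Lemma sum_chi_dotp d (xi : 'rV['F_p]_d) :
  \sum_x chi (dotp xi x) = if xi == 0 then p%:R ^+ d else 0.
Proof.
case: eqP => [-> | /eqP/rV0Pn[i xi_i]].
  under eq_bigr => x _ do rewrite /dotp mul0mx mxE chi0.
  by rewrite sumr_const card_mx card_Fp // mul1n natrX.
set S := \sum_x _.
have S_shift : S = S * chi (xi 0 i).
  rewrite {1}/S (reindex_inj (addIr (delta_mx 0 i))) mulr_suml.
  apply: eq_bigr => x _; rewrite dotpDr chiD; congr (_ * chi _).
  by rewrite /dotp trmx_delta -colE mxE.
apply/eqP; move/eqP: S_shift.
rewrite -subr_eq0 -{1}[S]mulr1 -mulrBr mulf_eq0 subr_eq0 => /orP[//|].
by rewrite eq_sym (negPf (chi_neq1 xi_i)).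
Qed.

Let pX_neq0 d : p%:R ^+ d != 0 :> R[i].
Proof. by rewrite expf_neq0 // pnatr_eq0 -lt0n prime_gt0. Qed.

Lemma fourier_inversion d (f : 'rV['F_p]_d -> R[i]) x :
  f x = \sum_xi fourier f xi * chi (dotp xi x).
Proof.
under eq_bigr => xi _.
  rewrite fourierE -mulrA mulr_suml.
  under eq_bigr => y _ do rewrite -mulrA -chiD addrC -dotpBr dotpC.
  over.
rewrite -mulr_sumr exchange_big /=.
under eq_bigr => y _ do rewrite -mulr_sumr sum_chi_dotp subr_eq0.
rewrite (bigD1 x) //= eqxx big1 ?addr0 => [|y /negPf y_neq].
  by rewrite mulrCA mulVf // mulr1.
by rewrite eq_sym y_neq mulr0.
Qed.

(** Expand [f] by Fourier inversion; orthogonality on the parameter space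
    then selects the frequencies that restrict to [eta]. *)
Lemma fourier_affine m d (f : 'rV['F_p]_d -> R[i]) (a : 'rV_d)
    (M : 'M['F_p]_(m, d)) (eta : 'rV_m) :
  fourier (fun t : 'rV_m => f (a + t *m M)) eta =
  \sum_(xi | xi *m M^T == eta) fourier f xi * chi (dotp xi a).
Proof.
rewrite fourierE.
under eq_bigr => t _.
  rewrite fourier_inversion mulr_suml.
  under eq_bigr => xi _.
    rewrite dotpDr chiD mulrA -mulrA -chiD dotp_mulmx -dotpBl.
    over.
  over.
rewrite exchange_big mulr_sumr [RHS]big_mkcond /=.
apply: eq_bigr => xi _.
rewrite -mulr_sumr sum_chi_dotp subr_eq0; case: ifP => _; last by rewrite !mulr0.
by rewrite mulrCA mulVf // mulr1.
Qed.

Lemma normc_sum_le (I : finType) (P : pred I) (z : I -> R[i]) :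
  ComplexField.Normc.normc (\sum_(i | P i) z i) <=
  \sum_(i | P i) ComplexField.Normc.normc (z i).
Proof.
elim/big_rec2: _ => [|i x y _ le_yx]; first by rewrite ComplexField.Normc.normc0.
by apply: le_trans (le_normcD _ _) _; rewrite lerD2l.
Qed.

(** By the triangle inequality in [fourier_affine]: the fibres of
    [xi |-> xi *m M^T] partition the frequencies of [f]. *)
Lemma wiener_norm_affine m d (f : 'rV['F_p]_d -> R[i]) (a : 'rV_d)
    (M : 'M['F_p]_(m, d)) :
  wiener_norm (fun t : 'rV_m => f (a + t *m M)) <= wiener_norm f.
Proof.
rewrite /wiener_norm [leRHS](partition_big (fun xi => xi *m M^T) predT) //=.
apply: ler_sum => eta _; rewrite fourier_affine.
apply: le_trans (normc_sum_le _ _) _; apply: ler_sum => xi _.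
by rewrite ComplexField.Normc.normcM normc_chi mulr1.
Qed.

End Characters.

(** * The second moment over random lines *)

Section Lines.
Variables (R : realFieldType) (K : finFieldType) (d : nat).
Implicit Types (g : 'rV[K]_d -> R) (a v : 'rV[K]_d) (t : 'rV[K]_1).

Let sum_translate g a : \sum_x g (a + x) = \sum_x g x.
Proof. by rewrite [RHS](reindex_inj (addrI a)). Qed.

Let sum_indicator (T : finType) (P : pred T) :
  \sum_x (P x)%:R = #|P|%:R :> R.
Proof.
by rewrite -natr_sum -sum1_card [in RHS]big_mkcond.
Qed.

(** The points [a + t v] and [a + t' v] are independent and uniform, so that
    a function of mean zero has no correlation between them. *)
Lemma sum_two_points g t t' : \sum_x g x = 0 -> t != t' ->
  \sum_a \sum_v g (a + t *m v) * g (a + t' *m v) = 0.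
Proof.
move=> g0 t_neq; rewrite exchange_big /=.
under eq_bigr => v _.
  rewrite (reindex_inj (addIr (- (t *m v)))) /=.
  under eq_bigr => a _ do rewrite subrK -addrA [- _ + _]addrC -mulmxBl.
  over.
rewrite exchange_big big1 //= => a _; rewrite -mulr_sumr.
have u_neq0 : (t' - t) 0 0 != 0.
  apply: contraNneq t_neq => u0.
  by rewrite eq_sym -subr_eq0 [t' - t]mx11_scalar u0 raddf0.
have scale_inj : injective (fun v : 'rV[K]_d => (t' - t) 0 0 *: v).
  exact: scalerI.
suff -> : \sum_v g (a + (t' - t) *m v) = \sum_v g (a + v).
  by rewrite sum_translate g0 mulr0.
rewrite [RHS](reindex_inj scale_inj); apply: eq_bigr => v _.
by rewrite [t' - t in LHS]mx11_scalar mul_scalar_mx.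
Qed.

(** Expanding the square, the terms with two distinct parameters cancel by
    [sum_two_points]. *)
Lemma line_second_moment g : \sum_x g x = 0 ->
  \sum_a \sum_v (\sum_(t : 'rV_1) g (a + t *m v)) ^+ 2 =
  #|K|%:R * #|K|%:R ^+ d * \sum_x g x ^+ 2.
Proof.
move=> g0.
under eq_bigr => a _ do under eq_bigr => v _ do
  rewrite expr2 big_distrlr /=.
under eq_bigr => a _ do rewrite exchange_big /=.
rewrite exchange_big /=.
under eq_bigr => t _.
  under eq_bigr => a _ do rewrite exchange_big /=.
  rewrite exchange_big (bigD1 t) //= [X in _ + X]big1 => [|t' t_neq]; last first.
    by rewrite sum_two_points // eq_sym.
  rewrite addr0 exchange_big /=.
  under eq_bigr => v _ do under eq_bigr => a _ do rewrite -expr2 addrC.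
  under eq_bigr => v _ do rewrite (sum_translate (fun x => g x ^+ 2)).
  rewrite sumr_const card_mx mul1n -mulr_natl natrX.
  over.
by rewrite sumr_const card_mx mul1n expn1 -[LHS]mulr_natl mulrA.
Qed.

(** Apply [line_second_moment] to the indicator of [S] minus [delta]: the
    squared deviation averages to [#|K| delta (1 - delta)], and some line does
    not exceed the average. *)
Lemma exists_balanced_line (S : pred 'rV[K]_d) (delta : R) :
  #|S|%:R = delta * #|K|%:R ^+ d ->
  exists a v,
    (#|[pred t : 'rV[K]_1 | S (a + t *m v)]|%:R - #|K|%:R * delta) ^+ 2 <=
    #|K|%:R * delta.
Proof.
move=> cardS.
set q : R := #|K|%:R ^+ d.
have sum_cst (c : R) : \sum_(x : 'rV[K]_d) c = c * q.
  by rewrite sumr_const card_mx mul1n -[LHS]mulr_natr natrX.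
have q_gt0 : 0 < q by rewrite exprn_gt0 // ltr0n; apply/card_gt0P; exists 0.
pose g x : R := (S x)%:R - delta.
have sumS : \sum_x (S x)%:R = delta * q.
  by rewrite -cardS sum_indicator.
have g0 : \sum_x g x = 0.
  by rewrite sumrB sumS sum_cst subrr.
have g2 : \sum_x g x ^+ 2 = delta * q * (1 - delta).
  under eq_bigr => x _.
    rewrite (_ : g x ^+ 2 = (1 - 2 * delta) * (S x)%:R + delta ^+ 2); last first.
      by rewrite /g; case: (S x) => /=; ring.
    over.
  by rewrite big_split /= -mulr_sumr sumS sum_cst; ring.
have deviation a v : \sum_(t : 'rV_1) g (a + t *m v) =
    #|[pred t : 'rV[K]_1 | S (a + t *m v)]|%:R - #|K|%:R * delta.
  rewrite sumrB sumr_const card_mx muln1 expn1 mulr_natl.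
  by rewrite -[in RHS]sum_indicator.
apply/not_existsP => no_line.
have := line_second_moment g0; rewrite g2 => moment.
suff : \sum_(a : 'rV[K]_d) \sum_(v : 'rV[K]_d) #|K|%:R * delta <
       \sum_a \sum_v (\sum_(t : 'rV_1) g (a + t *m v)) ^+ 2.
  rewrite moment; apply/negP; rewrite -leNgt.
  rewrite !sum_cst -/q.
  rewrite -subr_ge0 (_ : _ - _ = #|K|%:R * (delta * q) ^+ 2); last by ring.
  by rewrite mulr_ge0 // sqr_ge0.
have lt_line a v :
    #|K|%:R * delta < (\sum_(t : 'rV_1) g (a + t *m v)) ^+ 2.
  rewrite deviation ltNge; apply/negP => le_av.
  by apply: (no_line a); exists v.
by apply: ltr_sum => [|a _]; [|apply: ltr_sum => [|v _]];
   rewrite ?lt_line //; apply/hasP; exists 0; rewrite ?mem_index_enum.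
Qed.

End Lines.

Theorem theorem3 (R : realType) :
  exists C C' : R, [/\ 0 < C, 0 < C' &
    forall (p d : nat) (E : set R[i]) (F : R -> \bar R),
      prime p -> (1 <= d)%N ->
      (forall delta : R, F delta <> -oo%E) ->
      (forall delta : R, ~ (p%:R * delta \is a Num.int) -> F delta = +oo%E) ->
      (forall h : 'rV['F_p]_1 -> R[i],
          (forall x, (E `|` [set 0]) (h x)) ->
          (F (#|support h|%:R * p%:R^-1)%R <= (wiener_norm h)%:E)%E) ->
      forall (f : 'rV['F_p]_d -> R[i]) (delta : R),
        (forall x, (E `|` [set 0]) (f x)) ->
        #|support f|%:R = delta * p%:R ^+ d ->
        C * p%:R^-1 <= delta ->
        exists delta' : R,
          `|delta' - delta| <= C' * Num.sqrt delta * (Num.sqrt p%:R)^-1 /\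
          (F delta' <= (wiener_norm f)%:E)%E].
Proof.
exists 1, 1; split=> // p d E F p_pr _ _ _ lower_bound f delta fE cardf.
rewrite mul1r => delta_ge.
have p_gt0 : 0 < p%:R :> R by rewrite ltr0n prime_gt0.
have [|a [v]] := @exists_balanced_line R 'F_p d (support f) delta.
  by rewrite card_Fp.
rewrite card_Fp //; set X := #|_|%:R => deviation.
pose h (t : 'rV['F_p]_1) := f (a + t *m v).
exists (X / p%:R); split; last first.
  apply: le_trans (lower_bound h _) _ => [t|]; first exact: fE.
  by rewrite lee_fin wiener_norm_affine.
have delta_ge0 : 0 <= delta by apply: le_trans delta_ge; rewrite invr_ge0 ltW.
rewrite mul1r -(sqrtrV (ltW p_gt0)) -sqrtrM // -sqrtr_sqr; apply: ler_wsqrtr.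
rewrite (_ : X / p%:R - delta = (X - p%:R * delta) / p%:R); last first.
  by rewrite mulrBl [_ * delta]mulrC mulfK ?gt_eqF.
rewrite expr_div_n ler_pdivrMr ?exprn_gt0 //.
by apply: le_trans deviation _; rewrite expr2 mulrA mulfVK ?gt_eqF // mulrC.
Qed.
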